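(* Let $m\geq 1$ be an integer, let $\varphi:\mathbf{Z}/m\mathbf{Z}\to\mathbf{C}$ be a function, and put $c=\max(\|\varphi\|_{\infty},\|\widehat{\varphi}\|_{\infty})$. For any interval $I$ in $\mathbf{Z}$ with $\sqrt{m}<|I|\leq m$, we have $$\Bigl|\sum_{n\in I}\varphi(n)\Bigr|\leq c\sqrt{m}\,\log\Bigl(\frac{4e^{8}|I|}{m^{1/2}}\Bigr).$$
   Context: A function $\varphi:\mathbf{Z}/m\mathbf{Z}\to\mathbf{C}$ is also viewed as an $m$-periodic function on $\mathbf{Z}$. Its normalized Fourier transform is $\widehat{\varphi}(h)=\frac{1}{\sqrt m}\sum_{x \bmod m}\varphi(x)e(hx/m)$ for $h\in\mathbf{Z}$, where $e(t)=\exp(2\pi i t)$. The norm $\|\cdot\|_\infty$ is the maximum of the absolute value over $\mathbf{Z}/m\mathbf{Z}$. An interval in $\mathbf{Z}$ is a set of consecutive integers, and $|I|$ denotes its cardinality. *)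

(* Defs.v *)
From HB Require Import structures.
From mathcomp Require Import all_boot all_order all_algebra.
From mathcomp Require Import finmap complex.
From mathcomp Require Import all_classical all_reals all_analysis.

Set Implicit Arguments.
Unset Strict Implicit.
Unset Printing Implicit Defensive.
Import Order.TTheory GRing.Theory Num.Theory.

Local Open Scope ring_scope.
Local Open Scope complex_scope.

(* The carrier of Z/mZ is 'I_m rather than 'Z_m, because 'Z_1 has two
   elements. *)

Lemma residue_subproof (m : nat) (hm : (0 < m)%N) (n : int) :
  (`|(n %% m%:Z)%Z|%N < m)%N.
Proof.
rewrite -ltz_nat gez0_abs ?ltz_pmod ?ltz_nat //.
by rewrite modz_ge0 // gt_eqF // ltz_nat.
Qed.

Definition residue (m : nat) (hm : (0 < m)%N) (n : int) : 'I_m :=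
  Ordinal (residue_subproof hm n).

(* exp(2 pi i t) for real t, by Euler's formula. *)
Definition e (R : realType) (t : R) : R[i] :=
  cos (2 * pi * t) +i* sin (2 * pi * t).

(* The value depends only on h modulo m. *)
Definition fourier (R : realType) (m : nat) (phi : 'I_m -> R[i]) (h : int) :
    R[i] :=
  ((Num.sqrt (m%:R : R))^-1)%:C *
  \sum_(x < m) phi x * e (h%:~R * x%:R / m%:R : R).

(* [Normc.normc] is the complex modulus with values in R; the generic
   norm `|z| of R[i] has values in R[i]. *)
Definition supnorm (R : realType) (m : nat) (f : 'I_m -> R[i]) : R :=
  \big[Num.max/0]_(x < m) Normc.normc (f x).

Definition is_int_interval (I : {fset int}) : Prop :=
  forall a b n : int, a \in I -> b \in I -> a <= n <= b -> n \in I.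

(* Main.v *)
Require Import Defs.
From HB Require Import structures.
From mathcomp Require Import all_boot all_order all_algebra.
From mathcomp Require Import finmap complex.
From mathcomp Require Import all_classical all_reals all_analysis.
From mathcomp Require Import ring lra zify.

(** The sum over an interval [I] of length [N] is compared with its mean over
    the shifts [I], [I + 1], ..., [I + K - 1], where [K] is the least integer at
    least [sqrt m].  Shifting by [k] changes only [2 k] terms, so passing to the
    mean costs at most [(K - 1) c <= c sqrt m] ([normc_interval_sum_le]).

    The mean is expanded by Fourier inversion.  The frequency [h] then carries
    the factor [A_K(h) A_N(h) / K], a product of two geometric sums, where
    [A_n(h)] is at most [n] and at most [m / (2 j)], [j] being the distance from
    [h] to the nearest multiple of [m]; the constant [2] comes from the
    inequality [sin x >= 2 x / pi] on [[0, pi / 2]].  Averaging over shifts is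
    what makes this kernel decay like [1 / j ^ 2] beyond [m / (2 K)]
    ([kernel_le]): without it the sum over [h] would give [log N] where
    [log (N / sqrt m)] is wanted.

    With [a = m / (2 N)] and [d = m / (2 K)], the kernel at [h] is thus at most
    [(m / 2) min (1 / a, 1 / j, d / j ^ 2)].  The sum of these minima over
    [j >= 1] is the sum of [1 / j] over [a < j < d], that is [log (d / a)], plus
    a bounded amount: [comparison] is an explicit function whose increments
    dominate the minima and whose total variation is at most [log (d / a) + 7].
    Here [d / a = N / K <= N / sqrt m].

    Altogether the sum is at most [c sqrt m] times [1] (edges) plus
    [N / m <= 1] (zero frequency) plus [log (N / sqrt m) + 7], and
    [9 <= log (4 e ^ 8)]. *)

Set Implicit Arguments.
Unset Strict Implicit.
Unset Printing Implicit Defensive.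
Import Order.TTheory GRing.Theory Num.Theory.
Import numFieldNormedType.Exports.

Local Open Scope ring_scope.
Local Open Scope complex_scope.

Local Notation normc := Normc.normc.

(** * The complex modulus *)

Lemma normc_sum_le (R : rcfType) (T : Type) (r : seq T) (P : pred T)
    (F : T -> R[i]) :
  normc (\sum_(i <- r | P i) F i) <= \sum_(i <- r | P i) normc (F i).
Proof.
elim/big_rec2: _ => [|i y x _ h]; first by rewrite Normc.normc0.
by apply: le_trans (le_normcD _ _) _; rewrite lerD2l.
Qed.

Lemma normc_ge0 (R : rcfType) (z : R[i]) : 0 <= normc z.
Proof. by case: z => a b /=; exact: sqrtr_ge0. Qed.

Lemma normc_real (R : rcfType) (x : R) : normc x%:C = `|x|.
Proof. by rewrite /= expr0n addr0 sqrtr_sqr. Qed.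

(** * The exponential and the distance from [e t] to 1 *)

Section Exponential.
Variable R : realType.
Implicit Types s t : R.

Lemma eD s t : e (s + t) = e s * e t.
Proof. by rewrite /e mulrDr cosD sinD; simpc; rewrite [X in _ +i* X]addrC. Qed.

Lemma e0 : e (0 : R) = 1.
Proof. by rewrite /e mulr0 cos0 sin0. Qed.

Lemma e_nat (n : nat) : e (n%:R : R) = 1.
Proof.
elim: n => [|n IH]; first exact: e0.
rewrite -natr1 eD IH mul1r /e mulr1 mulrC mulr_natr.
by rewrite cos2pi sin2pi.
Qed.

Lemma e_int (k : int) : e (k%:~R : R) = 1.
Proof.
case: k => n; first by rewrite -pmulrn e_nat.
have := eD (n.+1%:R) (Negz n)%:~R.
by rewrite e_nat mul1r NegzE mulrNz -pmulrn subrr e0 => <-.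
Qed.

Lemma eXn t n : e t ^+ n = e (n%:R * t).
Proof.
elim: n => [|n IH]; first by rewrite expr0 mul0r e0.
by rewrite exprS IH -eD -natr1 mulrDl mul1r addrC.
Qed.

Lemma normc_e t : normc (e t) = 1.
Proof. by rewrite /e /= cos2Dsin2 sqrtr1. Qed.

Lemma normc_1Be t : normc (1 - e t) = 2 * `|sin (pi * t)|.
Proof.
rewrite /e; set x := pi * t.
have -> : 2 * pi * t = x *+ 2 by rewrite /x -mulr_natl; ring.
rewrite sin_mulr2n cos_mulr2n; simpc => /=.
rewrite cos2sin2.
set c := cos x; set s := sin x.
have hc : c ^+ 2 = 1 - s ^+ 2 := cos2sin2 x.
rewrite (_ : _ + _ = (2 * s) ^+ 2); last first.
  transitivity (4 * s ^+ 4 + 4 * c ^+ 2 * s ^+ 2); first by ring.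
  by rewrite hc; ring.
by rewrite sqrtr_sqr normrM normr_nat.
Qed.

(** Concavity of [sin], through the mean value theorem: if [sin x] were below
    the chord from [0] to [pi / 2], the slope [cos] would be smaller than
    [2 / pi] somewhere before [x] and larger somewhere after it, although [cos]
    decreases. *)
Lemma jordan_sin x : 0 <= x <= pi / 2 -> 2 / pi * x <= sin x :> R.
Proof.
have pi0 := pi_gt0 R.
case/andP; rewrite le_eqVlt => /predU1P[<- _|x0]; first by rewrite mulr0 sin0.
rewrite le_eqVlt => /predU1P[->|x1].
  by rewrite sin_pihalf mulrA divfK ?divff ?lexx // gt_eqF.
have mvt (u v : R) : u < v ->
    exists2 w, w \in `]u, v[%R & sin v - sin u = cos w * (v - u).
  move=> uv; apply: MVT => //.
  exact/continuous_subspaceT/continuous_sin.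
have [y] := mvt _ _ x0; rewrite in_itv/= sin0 !subr0 => /andP[y0 yx] ey.
have [z] := mvt _ _ x1; rewrite in_itv/= sin_pihalf => /andP[xz z1] ez.
have czy : cos z < cos y.
  by rewrite ltr_cos ?in_itv/= ?(lt_trans yx xz)//; apply/andP; split; lra.
have cz : cos z * (pi / 2 - x) <= cos y * (pi / 2 - x).
  by rewrite ler_pM2r ?ltW // subr_gt0.
rewrite mulrAC ler_pdivrMr //.
nra.
Qed.

(** The chord between [1] and [e t] has length [2 sin (pi t)], which is symmetric
    under [t -> 1 - t]; on [[0, 1 / 2]] it is at least [4 t] by
    [jordan_sin]. *)
Lemma normc_1Be_ge t : 0 <= t <= 1 -> 4 * Num.min t (1 - t) <= normc (1 - e t).
Proof.
move=> /andP[t0 t1]; have pi0 := pi_gt0 R.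
have half (s : R) : 0 <= s <= 2^-1 -> 4 * s <= 2 * sin (pi * s).
  move=> s01; have /jordan_sin : 0 <= pi * s <= pi / 2.
    by apply/andP; split; nra.
  by rewrite mulrA divfK ?gt_eqF //; lra.
rewrite normc_1Be ger0_norm; last first.
  by apply: sin_ge0_pi; apply/andP; split; nra.
have [th|th] := leP t (1 - t); first by apply: half; lra.
rewrite [sin (pi * t)](_ : _ = sin (pi * (1 - t))); first by apply: half; lra.
by rewrite mulrBr mulr1 sinB sinpi cospi mul0r sub0r mulN1r opprK.
Qed.

End Exponential.

(** * A telescoping majorant *)

Section Telescope.
Variable R : realType.
Implicit Types a d x y : R.

(** An approximate antiderivative of [x -> min (1 / a, 1 / x, d / x ^ 2)].  The
    difference of logarithms has derivative [1 / (x + a) - 1 / (x + d)], of size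
    [1 / x] between [a] and [d]; the last two terms repair the ranges near [a]
    and near [d], and [1 / (x + d)] pays for replacing the derivative of
    [ln (x + d)] by a unit step. *)
Definition comparison a d x : R :=
  ln (x + a) - ln (x + d) - (x + d)^-1 - 2 * (a / (x + a)) - 3 * (d / (x + d)).

Lemma ln_step_ge x : 1 < x -> x^-1 <= ln x - ln (x - 1).
Proof.
move=> x1; rewrite -lerN2 opprB -ln_div ?posrE; try lra.
have x0 : x != 0 by rewrite gt_eqF; lra.
have -> : (x - 1) / x = 1 + - x^-1 by field.
by apply: le_ln1Dx; rewrite ltrN2 invf_lt1; lra.
Qed.

Lemma ln_step_le x : 1 < x -> ln x - ln (x - 1) <= (x - 1)^-1.
Proof.
move=> x1; rewrite -ln_div ?posrE; try lra.
have x0 : x - 1 != 0 by rewrite gt_eqF; lra.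
have -> : x / (x - 1) = 1 + (x - 1)^-1 by field.
by apply: le_ln1Dx; apply: (@lt_trans _ _ 0); rewrite ?invr_gt0; lra.
Qed.

(** For [x <= d] the bounds [1 / a] and [1 / x] give
    [y <= 1 / (x + a) + 2 a / (x + a) ^ 2], and [1 / (x + d)] is absorbed by
    [3 d / (x + d) ^ 2].  For [x > d], writing [v = 1 / (x + d)], the right-hand
    side is at least [(d - a) v ^ 2 + 2 a v ^ 2 + 3 d v ^ 2 >= 4 d v ^ 2], and
    [4 v ^ 2 >= 1 / x ^ 2]. *)
Lemma min_profile_le a d x y : 0 < a -> a <= d -> 0 < x ->
  y <= a^-1 -> y <= x^-1 -> y <= d / x ^+ 2 ->
  y <= (x + a)^-1 - (x + d)^-1 + 2 * (a / (x + a) ^+ 2)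
         + 3 * (d / (x + d) ^+ 2).
Proof.
move=> a0 ad x0 ya yx yd.
have d0 : 0 < d by lra.
have xa : 0 < x + a by lra.
have xd : 0 < x + d by lra.
have [le_xd|lt_dx] := leP x d.
  have h1 : y <= (x + a)^-1 + 2 * (a / (x + a) ^+ 2).
    have -> : (x + a)^-1 + 2 * (a / (x + a) ^+ 2) = (x + 3 * a) / (x + a) ^+ 2.
      by field; rewrite gt_eqF.
    have [xa'|ax] := leP x a.
      apply: le_trans ya _; rewrite ler_pdivlMr ?exprn_gt0 // mulrC.
      by rewrite ler_pdivrMr //; nra.
    apply: le_trans yx _; rewrite ler_pdivlMr ?exprn_gt0 // mulrC.
    by rewrite ler_pdivrMr //; nra.
  have h2 : (x + d)^-1 <= 3 * (d / (x + d) ^+ 2).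
    by rewrite mulrA ler_pdivlMr ?exprn_gt0 // expr2 mulrA mulVf ?gt_eqF //; lra.
  lra.
set u := (x + a)^-1; set v := (x + d)^-1.
have v0 : 0 < v by rewrite invr_gt0.
have vu : v <= u by rewrite lef_pV2 ?posrE //; lra.
have uv : u - v = (d - a) * (u * v).
  by rewrite /u /v; field; rewrite !gt_eqF.
have h : d / x ^+ 2 <= 4 * d * v ^+ 2.
  rewrite ler_pdivrMr ?exprn_gt0 // /v.
  have -> : 4 * d * (x + d)^-1 ^+ 2 * x ^+ 2 = d * (2 * (x / (x + d))) ^+ 2.
    by field; rewrite gt_eqF.
  have : 1 <= 2 * (x / (x + d)) by rewrite mulrA ler_pdivlMr //; lra.
  by move=> w1; rewrite ler_peMr ?(ltW d0) ?exprn_ege1.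
rewrite -!exprVn -/u -/v.
have : v ^+ 2 <= u * v by rewrite expr2 ler_pM2r.
have : v ^+ 2 <= u ^+ 2 by nra.
set vv := v ^+ 2 in h *; set uu := u ^+ 2; move=> h1 h2.
have : 0 <= a * vv by rewrite mulr_ge0 ?sqr_ge0 ?ltW.
have : a * vv <= a * uu by rewrite ler_pM2l.
have : (d - a) * vv <= (d - a) * (u * v) by rewrite ler_wpM2l // subr_ge0.
lra.
Qed.

(** Each term of [min_profile_le] is bounded by a unit increment:
    [1 / (x + a)] and [1 / (x - 1 + d)] by increments of logarithms, and
    [b / (x + b) ^ 2] by [b / (x - 1 + b) - b / (x + b)]. *)
Lemma comparison_step a d x y : 0 < a -> a <= d -> 1 <= x ->
  y <= a^-1 -> y <= x^-1 -> y <= d / x ^+ 2 ->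
  y <= comparison a d x - comparison a d (x - 1).
Proof.
move=> a0 ad x1 ya yx yd.
have x0 : 0 < x by lra.
apply: le_trans (min_profile_le a0 ad x0 ya yx yd) _.
have inv_step (b : R) : 0 < b -> b / (x + b) ^+ 2 <= b / (x - 1 + b) - b / (x + b).
  move=> b0; have h1 : 0 < x + b by lra.
  have h2 : 0 < x - 1 + b by lra.
  have -> : b / (x - 1 + b) - b / (x + b) = b / ((x - 1 + b) * (x + b)).
    by field; rewrite !gt_eqF.
  by rewrite ler_pM2l // lef_pV2 ?posrE ?mulr_gt0 ?exprn_gt0 //; nra.
have d0 : 0 < d by lra.
have := inv_step _ a0; have := inv_step _ d0.
have /ln_step_ge : 1 < x + a by lra.
have /ln_step_le : 1 < x + d by lra.
have -> : x + d - 1 = x - 1 + d by ring.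
have -> : x + a - 1 = x - 1 + a by ring.
rewrite /comparison; lra.
Qed.

Lemma comparison_total a d x : 0 < a -> a <= d -> 2^-1 <= d -> 0 <= x ->
  comparison a d x - comparison a d 0 <= ln (d / a) + 7.
Proof.
move=> a0 ad d12 x0; have d0 : 0 < d by lra.
rewrite ln_div ?posrE // /comparison !add0r !divff ?gt_eqF //.
have : ln (x + a) <= ln (x + d) by rewrite ler_ln ?posrE; lra.
have : 0 <= (x + d)^-1 by rewrite invr_ge0; lra.
have : 0 <= a / (x + a) by rewrite divr_ge0; lra.
have : 0 <= d / (x + d) by rewrite divr_ge0; lra.
have : d^-1 <= 2 by rewrite invf_ple ?posrE //; lra.
lra.
Qed.

End Telescope.

(** * Geometric sums *)

Section Geometric.
Variable R : realType.

Lemma normc_geometric_le (z : R[i]) (n : nat) :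
  normc z = 1 -> normc (\sum_(i < n) z ^+ i) <= n%:R.
Proof.
move=> z1; apply: le_trans (normc_sum_le _ _ _) _.
rewrite (eq_bigr (fun=> 1)) ?sumr_const ?card_ord // => i _.
by elim: (nat_of_ord i) => [|k IH];
  rewrite ?expr0 ?Normc.normc1 // exprS Normc.normcM z1 mul1r.
Qed.

Lemma normc_geometric_mul_le (z : R[i]) (n : nat) :
  normc z = 1 -> normc (\sum_(i < n) z ^+ i) * normc (1 - z) <= 2.
Proof.
move=> z1; rewrite -Normc.normcM mulrC -[1 - z]opprB mulNr -subrX1 opprB.
apply: le_trans (le_normcD _ _) _.
rewrite normcN Normc.normc1 (_ : normc (z ^+ n) = 1) //.
by elim: n => [|n IH]; rewrite ?expr0 ?Normc.normc1 // exprS Normc.normcM z1 mul1r.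
Qed.

(** The distance from [h] to the nearest multiple of [m] is
    [minn h (m - h)], so [normc_1Be_ge] bounds the denominator
    [1 - z] of the geometric sum from below by [4 minn h (m - h) / m]. *)
Lemma normc_geometric_e_le (m h n : nat) : (0 < h < m)%N ->
  normc (\sum_(i < n) e (- (h%:R / m%:R : R)) ^+ i)
    <= m%:R / 2 / (minn h (m - h))%:R.
Proof.
case/andP=> h0 hm; have m0 : 0 < m%:R :> R by rewrite ltr0n (leq_trans _ hm).
have j0 : (0 < minn h (m - h))%N by rewrite leq_min h0 subn_gt0.
have j0R : 0 < (minn h (m - h))%:R :> R by rewrite ltr0n.
set t := h%:R / m%:R.
have t01 : 0 <= t <= 1.
  by rewrite divr_ge0 ?ler0n //= ler_pdivrMr // mul1r ler_nat ltnW.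
have := normc_geometric_mul_le n (normc_e (- t)).
rewrite normc_1Be mulrN sinN normrN -normc_1Be.
set G := normc (\sum_(i < n) _) => hG.
have : (minn h (m - h))%:R / m%:R = Num.min t (1 - t).
  have -> : 1 - t = (m - h)%:R / m%:R by rewrite natrB 1?ltnW // mulrBl divff ?gt_eqF.
  have [hle|hle] := leqP h (m - h).
    by rewrite min_l // ler_pM2r ?invr_gt0 // ler_nat.
  by rewrite min_r // ler_pM2r ?invr_gt0 // ler_nat ltnW.
have := normc_1Be_ge t01.
move=> + hj; rewrite -hj => hmin.
have hG' : G * (4 * ((minn h (m - h))%:R / m%:R)) <= 2.
  by apply: le_trans hG; rewrite ler_wpM2l // normc_ge0.
rewrite ler_pdivlMr // ler_pdivlMr // -(ler_pM2r (_ : 0 < 2 / m%:R)); last first.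
  by rewrite divr_gt0.
rewrite (mulrCA m%:R) divff ?gt_eqF // mulr1.
by apply: le_trans hG'; rewrite le_eqVlt; apply/orP; left; apply/eqP; ring.
Qed.

End Geometric.

(** * Fourier inversion modulo [m] *)

Section Inversion.
Variables (R : realType) (m : nat) (hm : (0 < m)%N).

Let m0 : m%:R != 0 :> R.
Proof. by rewrite pnatr_eq0 -lt0n. Qed.

(** When [m] does not divide [k], the common ratio [z = e (k / m)] satisfies
    [z ^ m = 1], so the sum is annihilated by [z - 1]; and [z <> 1] because, with
    [r] the residue of [k], the chord from [1] to [e (r / m)] has positive
    length. *)
Lemma sum_additive_character (k : int) :
  \sum_(h < m) e (k%:~R / m%:R : R) ^+ h
    = if (m%:Z %| k)%Z then m%:R else 0.
Proof.
have eq_e (q r : int) : e ((q * m%:Z + r)%:~R / m%:R : R) = e (r%:~R / m%:R).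
  rewrite intrD intrM mulrDl -[m%:Z%:~R]pmulrn mulfK //.
  by rewrite eD e_int mul1r.
case: ifPn => [/dvdzP[q ->]|ndvd].
  rewrite -[q * _]addr0 eq_e mul0r e0 (eq_bigr (fun=> 1)).
    by rewrite sumr_const card_ord.
  by move=> i _; rewrite expr1n.
set z := e _.
have : (z - 1) * \sum_(h < m) z ^+ h = 0.
  by rewrite -subrX1 eXn mulrC divfK // e_int subrr.
move/eqP; rewrite mulf_eq0 => /orP[|/eqP //].
rewrite subr_eq0 => /eqP z1; exfalso.
have [r [r0 rm kr]] : exists r : nat, [/\ (0 < r)%N, (r < m)%N & (k %% m)%Z = r%:Z].
  exists `|(k %% m)%Z|%N; split; last 2 first.
  - exact: residue_subproof.
  - by rewrite gez0_abs // modz_ge0 // gt_eqF // ltz_nat.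
  - by rewrite absz_gt0; apply: contra ndvd => /eqP h; apply/dvdz_mod0P.
have rmR : r%:R < m%:R :> R by rewrite ltr_nat.
have r0R : 0 < r%:R :> R by rewrite ltr0n.
have mR : 0 < m%:R :> R by rewrite ltr0n.
have t0 : 0 < r%:R / m%:R :> R by rewrite divr_gt0.
have t1 : r%:R / m%:R < 1 :> R by rewrite ltr_pdivrMr // mul1r.
have : 0 <= (r%:R / m%:R : R) <= 1 by rewrite !ltW.
move/normc_1Be_ge.
move: z1; rewrite /z {1}(divz_eq k m%:Z) eq_e kr -pmulrn => ->.
rewrite subrr Normc.normc0 leNgt => /negP; apply.
by rewrite mulr_gt0 // lt_min t0 subr_gt0.
Qed.

Lemma residue_eqP (x : 'I_m) (n : int) :
  (m%:Z %| x%:Z - n)%Z = (x == residue hm n).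
Proof.
rewrite -eqz_mod_dvd modz_small ?ltz_nat ?ltn_ord ?andbT //.
rewrite -val_eqE /= -eqz_nat gez0_abs // modz_ge0 // gt_eqF // ltz_nat //.
Qed.

Lemma fourier_inversion (phi : 'I_m -> R[i]) (n : int) :
  phi (residue hm n) = ((Num.sqrt (m%:R : R))^-1)%:C *
    \sum_(h < m) fourier phi h%:Z * e (- (h%:R / m%:R) * n%:~R).
Proof.
have mR : 0 < m%:R :> R by rewrite ltr0n.
transitivity (\sum_(x < m) phi x * ((m%:R^-1)%:C *
    \sum_(h < m) e ((x%:Z - n)%:~R / m%:R : R) ^+ h)).
  rewrite (bigD1 (residue hm n)) // sum_additive_character residue_eqP eqxx.
  rewrite -[m%:R in X in _ * (_ * X)](rmorph_nat (real_complex R)) -rmorphM.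
  rewrite mulVf // rmorph1 mulr1 /= big1 ?addr0 // => x xn.
  by rewrite sum_additive_character residue_eqP (negbTE xn) !mulr0.
rewrite mulr_sumr.
under eq_bigr do rewrite mulrA mulr_sumr.
rewrite exchange_big; apply: eq_bigr => h _ /=.
have sq : ((Num.sqrt m%:R)^-1)%:C * ((Num.sqrt m%:R)^-1)%:C = (m%:R^-1)%:C :> R[i].
  by rewrite -rmorphM -invfM -expr2 sqr_sqrtr ?ler0n.
rewrite /fourier !mulrA sq mulr_sumr mulr_suml; apply: eq_bigr => x _.
rewrite eXn [in RHS]mulrA -[in RHS]mulrA -eD [phi x * _]mulrC; congr (_ * e _).
by rewrite intrB -!pmulrn; field.
Qed.

End Inversion.

(** * Averaging over shifts *)

Section Sliding.
Variables (R : realType) (f : int -> R[i]) (C : R).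
Hypothesis f_le : forall n, normc (f n) <= C.

(** A unit shift of the interval drops one term and gains another. *)
Lemma normc_sliding_le (N : nat) (a : int) (k : nat) :
  normc (\sum_(i < N) f (a + k%:Z + i%:Z) - \sum_(i < N) f (a + i%:Z))
    <= 2 * k%:R * C.
Proof.
elim: k => [|k IH].
  by rewrite addr0 subrr Normc.normc0 mulr0 mul0r.
pose b := a + k%:Z.
(* Both sides plus [f b] are the sum of [N + 1] terms starting at [b]. *)
have step : \sum_(i < N) f (a + k.+1%:Z + i%:Z)
    = \sum_(i < N) f (b + i%:Z) + (f (b + N%:Z) - f b).
  have := big_ord_recl N (op := +%R) (idx := 0) (fun i => f (b + i%:Z)).
  rewrite big_ord_recr /= addr0 => E.
  rewrite addrA E addrAC subrr add0r; apply: eq_bigr => i _.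
  by congr f; rewrite /b /bump /=; lia.
rewrite step addrAC.
apply: le_trans (le_normcD _ _) _.
have := le_normcD (f (b + N%:Z)) (- f b); rewrite normcN.
have := f_le (b + N%:Z); have := f_le b.
by rewrite -natr1; move: IH; rewrite /b; lra.
Qed.

(** The loss [K (K - 1) C] is the sum over [k < K] of the bounds [2 k C] of
    [normc_sliding_le]. *)
Lemma normc_interval_sum_le (N K : nat) (a : int) :
  K%:R * normc (\sum_(i < N) f (a + i%:Z)) <=
    normc (\sum_(k < K) \sum_(i < N) f (a + k%:Z + i%:Z))
      + K%:R * (K%:R - 1) * C.
Proof.
set S := \sum_(i < N) _.
have h : normc (K%:R * S - \sum_(k < K) \sum_(i < N) f (a + k%:Z + i%:Z))
    <= K%:R * (K%:R - 1) * C.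
  elim: K => [|K IH]; first by rewrite big_ord0 !mul0r subrr Normc.normc0.
  rewrite big_ord_recr /= -!natr1 mulrDl mul1r.
  set T := \sum_(k < K) _ in IH *; set U := \sum_(i < N) _.
  have -> : K%:R * S + S - (T + U) = (K%:R * S - T) - (U - S) by ring.
  apply: le_trans (le_normcD _ _) _; rewrite normcN.
  have := normc_sliding_le N a K; rewrite -/S -/U; lra.
set T := \sum_(k < K) _ in h *.
have -> : K%:R * normc S = normc (K%:R * S).
  by rewrite Normc.normcM -(rmorph_nat (real_complex R)) normc_real ger0_norm.
have -> : K%:R * S = T + (K%:R * S - T) by ring.
apply: le_trans (le_normcD _ _) _; lra.
Qed.

End Sliding.

(** The interval property fills everything between the least and the greatest
    element of [I]. *)
Lemma interval_enum (I : {fset int}) : is_int_interval I -> I != fset0 ->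
  exists a : int, perm_eq I [seq a + i%:Z | i <- iota 0 #|` I|].
Proof.
move=> hI /fset0Pn[x0 x0I].
have ext (s : seq int) x : x \in s ->
    exists a b, [/\ a \in s, b \in s & forall y, y \in s -> a <= y <= b].
  elim: s x => // u s IH x _.
  case: s IH => [_|v s IH].
    by exists u, u; split; rewrite ?inE // => y; rewrite inE => /eqP ->; rewrite lexx.
  have [|a [b [aI bI hab]]] := IH v; first by rewrite inE eqxx.
  exists (Num.min u a), (Num.max u b); split.
  - by case: (leP u a) => _; rewrite inE ?eqxx // aI orbT.
  - by case: (leP u b) => _; rewrite inE ?eqxx // bI orbT.
  - move=> y; rewrite inE ge_min le_max => /predU1P[->|/hab /andP[-> ->]].
      by rewrite lexx.
    by rewrite !orbT.
have [a [b [aI bI hab]]] := ext _ _ x0I.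
have ab : a <= b by have /andP[] := hab _ bI.
have P : perm_eq I [seq a + i%:Z | i <- iota 0 `|b - a|%N.+1].
  apply: uniq_perm; first exact: fset_uniq.
    by rewrite map_inj_uniq ?iota_uniq // => i j /addrI [].
  move=> y; apply/idP/mapP => [yI|[i +]].
    have /andP[ay yb] := hab _ yI.
    by exists `|y - a|%N; [rewrite mem_iota; lia|lia].
  rewrite mem_iota => hi ->; apply: hI aI bI _; lia.
exists a; rewrite (_ : #|` I| = `|b - a|%N.+1) //.
by rewrite (perm_size P) size_map size_iota.
Qed.

(** * The smoothed kernel *)

Section Kernel.
Variable R : realType.

(** The three bounds required by [comparison_step] at
    [j = minn h (m - h)] come from bounding the two geometric sums by their
    lengths, one by its length and the other by [m / (2 j)], and both by
    [m / (2 j)].  As the increments of [comparison] are nonnegative, the one at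
    [j] is at most the sum of those at [h] and [m - h]; this form avoids any
    discussion of the parity of [m] when summing over [h]. *)
Lemma kernel_le (m N K h : nat) (z : R[i] := e (- (h%:R / m%:R)))
    (G := comparison (m%:R / (2 * N%:R)) (m%:R / (2 * K%:R))) :
  (0 < K <= N)%N -> (N <= m)%N -> (0 < h < m)%N ->
  normc (\sum_(k < K) z ^+ k) * normc (\sum_(i < N) z ^+ i)
    <= K%:R * (m%:R / 2) * ((G h%:R - G (h%:R - 1))
         + (G (m - h)%:R - G ((m - h)%:R - 1))).
Proof.
move=> /andP[K0 KN] Nm hh; have [h0 hm] := andP hh.
have m0 : 0 < m%:R :> R by rewrite ltr0n (leq_trans _ hm).
have K0R : 0 < K%:R :> R by rewrite ltr0n.
have N0R : 0 < N%:R :> R by rewrite ltr0n (leq_trans K0).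
have a0 : 0 < m%:R / (2 * N%:R) :> R by rewrite divr_gt0 ?mulr_gt0.
have d0 : 0 < m%:R / (2 * K%:R) :> R by rewrite divr_gt0 ?mulr_gt0.
have ad : m%:R / (2 * N%:R) <= m%:R / (2 * K%:R) :> R.
  by rewrite ler_pM2l // lef_pV2 ?posrE ?mulr_gt0 // ler_pM2l // ler_nat.
have G0 (j : nat) : (0 < j)%N -> 0 <= G j%:R - G (j%:R - 1).
  move=> j0; have j0R : 0 < j%:R :> R by rewrite ltr0n.
  by apply: (comparison_step a0 ad); rewrite ?ler1n ?invr_ge0 ?ler0n //.
set j := minn h (m - h).
(* [j] is [h] or [m - h], and the other increment is nonnegative. *)
suff : normc (\sum_(k < K) z ^+ k) * normc (\sum_(i < N) z ^+ i)
    <= K%:R * (m%:R / 2) * (G j%:R - G (j%:R - 1)).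
  move=> /le_trans; apply; rewrite ler_pM2l ?mulr_gt0 //.
  have := G0 _ h0; have : 0 <= G (m - h)%:R - G ((m - h)%:R - 1).
    by apply: G0; rewrite subn_gt0.
  by rewrite /j; case: leqP => _; lra.
have j0 : (0 < j)%N by rewrite leq_min h0 subn_gt0.
have j0R : 0 < j%:R :> R by rewrite ltr0n.
have z1 : normc z = 1 := normc_e _.
have bK := normc_geometric_le K z1; have bN := normc_geometric_le N z1.
have cK : normc (\sum_(k < K) z ^+ k) <= m%:R / 2 / j%:R.
  exact: normc_geometric_e_le.
have cN : normc (\sum_(i < N) z ^+ i) <= m%:R / 2 / j%:R.
  exact: normc_geometric_e_le.
set A := normc _ in bK cK *; set B := normc _ in bN cN *.
have A0 : 0 <= A by exact: normc_ge0.
have B0 : 0 <= B by exact: normc_ge0.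
rewrite [leRHS]mulrC -ler_pdivrMr ?mulr_gt0 //.
apply: comparison_step => //; first by rewrite ler1n.
- rewrite ler_pdivrMr ?mulr_gt0 //.
  have -> : (m%:R / (2 * N%:R))^-1 * (K%:R * (m%:R / 2)) = N%:R * K%:R :> R.
    by field; rewrite !gt_eqF.
  by rewrite [leLHS]mulrC ler_pM.
- rewrite ler_pdivrMr ?mulr_gt0 //.
  have -> : j%:R^-1 * (K%:R * (m%:R / 2)) = m%:R / 2 / j%:R * K%:R :> R.
    by field; rewrite gt_eqF.
  by rewrite [leLHS]mulrC ler_pM.
- rewrite ler_pdivrMr ?mulr_gt0 //.
  have -> : m%:R / (2 * K%:R) / j%:R ^+ 2 * (K%:R * (m%:R / 2))
      = m%:R / 2 / j%:R * (m%:R / 2 / j%:R) :> R.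
    by field; rewrite !gt_eqF.
  by apply: ler_pM.
Qed.

(** The zero frequency contributes [K N]; over the others both increments of
    [comparison] telescope, the second one after the reflection
    [h -> m - h]. *)
Lemma kernel_sum_le (m N K : nat) : (0 < K <= N)%N -> (N <= m)%N ->
  \sum_(h < m) normc (\sum_(k < K) e (- (h%:R / m%:R : R)) ^+ k)
             * normc (\sum_(i < N) e (- (h%:R / m%:R : R)) ^+ i)
    <= K%:R * (N%:R + m%:R * (ln (N%:R / K%:R) + 7)).
Proof.
move=> KN Nm; have [K0 KN'] := andP KN.
have K0R : 0 < K%:R :> R by rewrite ltr0n.
have N0R : 0 < N%:R :> R by rewrite ltr0n (leq_trans K0).
case: m Nm => [|m] Nm; first by move: K0 KN'; lia.
have m0 : 0 < m.+1%:R :> R by rewrite ltr0n.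
rewrite big_ord_recl mulrDr; apply: lerD.
  by apply: ler_pM; rewrite ?normc_ge0 //; apply: normc_geometric_le; exact: normc_e.
set a := m.+1%:R / (2 * N%:R) : R; set d := m.+1%:R / (2 * K%:R) : R.
have a0 : 0 < a by rewrite divr_gt0 ?mulr_gt0.
have ad : a <= d.
  by rewrite ler_pM2l // lef_pV2 ?posrE ?mulr_gt0 // ler_pM2l // ler_nat.
have d12 : 2^-1 <= d.
  rewrite /d ler_pdivlMr ?mulr_gt0 // mulKf ?pnatr_eq0 // ler_nat.
  exact: leq_trans Nm.
pose G := comparison a d.
have tele n : \sum_(i < n) (G i.+1%:R - G (i.+1%:R - 1)) = G n%:R - G 0.
  elim: n => [|n IH]; first by rewrite big_ord0 subrr.
  by rewrite big_ord_recr /= IH -natr1 addrK addrC subrKA.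
have tot : G m%:R - G 0 <= ln (N%:R / K%:R) + 7.
  have -> : N%:R / K%:R = d / a by rewrite /d /a; field; rewrite !gt_eqF.
  by apply: comparison_total => //; exact: ler0n.
apply: (@le_trans _ _ (\sum_(i < m) K%:R * (m.+1%:R / 2) *
    ((G i.+1%:R - G (i.+1%:R - 1))
     + (G (m - i)%:R - G ((m - i)%:R - 1))))).
  apply: ler_sum => i _.
  have hi : (0 < lift ord0 i < m.+1)%N by rewrite lift0 /= ltnS.
  by have := kernel_le KN Nm hi; rewrite /= /bump /= add1n subSS.
rewrite -mulr_sumr big_split /= tele.
have -> : \sum_(i < m) (G (m - i)%:R - G ((m - i)%:R - 1)) = G m%:R - G 0.
  rewrite -tele (reindex_inj rev_ord_inj) /=; apply: eq_bigr => i _.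
  by rewrite subKn.
rewrite -mulrA ler_pM2l //.
have : m.+1%:R * (G m%:R - G 0) <= m.+1%:R * (ln (N%:R / K%:R) + 7).
  by rewrite ler_pM2l.
lra.
Qed.

End Kernel.

(** By [fourier_inversion], the double sum factors at each frequency into a
    phase and two geometric sums. *)
Lemma smoothed_sum_le (R : realType) (m : nat) (hm : (0 < m)%N)
    (phi : 'I_m -> R[i]) (C : R) (N K : nat) (a : int) :
  (forall h : 'I_m, normc (fourier phi h%:Z) <= C) ->
  (0 < K <= N)%N -> (N <= m)%N ->
  normc (\sum_(k < K) \sum_(i < N) phi (residue hm (a + k%:Z + i%:Z)))
    <= C / Num.sqrt m%:R * (K%:R * (N%:R + m%:R * (ln (N%:R / K%:R) + 7))).
Proof.
move=> hC KN Nm.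
have C0 : 0 <= C by apply: le_trans (hC (Ordinal hm)); exact: normc_ge0.
pose z (h : 'I_m) : R[i] := e (- (h%:R / m%:R)).
have -> : \sum_(k < K) \sum_(i < N) phi (residue hm (a + k%:Z + i%:Z))
    = ((Num.sqrt (m%:R : R))^-1)%:C *
      \sum_(h < m) fourier phi h%:Z * e (- (h%:R / m%:R) * a%:~R) *
        ((\sum_(k < K) z h ^+ k) * (\sum_(i < N) z h ^+ i)).
  under eq_bigr => k _ do under eq_bigr => i _ do rewrite fourier_inversion.
  under eq_bigr do rewrite -mulr_sumr exchange_big.
  rewrite -mulr_sumr exchange_big; congr (_ * _); apply: eq_bigr => h _ /=.
  rewrite mulr_suml mulr_sumr; apply: eq_bigr => k _.
  rewrite mulr_sumr mulr_sumr; apply: eq_bigr => i _.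
  rewrite -mulrA; congr (_ * _).
  rewrite /z !eXn -!eD !intrD -!pmulrn; congr e; ring.
rewrite Normc.normcM normc_real ger0_norm ?invr_ge0 ?sqrtr_ge0 //.
rewrite [C / _]mulrC -mulrA ler_wpM2l ?invr_ge0 ?sqrtr_ge0 //.
apply: le_trans (normc_sum_le _ _ _) _.
apply: le_trans (ler_wpM2l C0 (kernel_sum_le R KN Nm)).
rewrite mulr_sumr; apply: ler_sum => h _.
rewrite Normc.normcM (Normc.normcM (fourier _ _)) normc_e mulr1.
rewrite (Normc.normcM (\sum_(k < K) _)).
by apply: ler_wpM2r; [rewrite mulr_ge0 ?normc_ge0|exact: hC].
Qed.

Lemma exists_ceil_sqrt (R : realType) (m N : nat) : (0 < m)%N ->
  Num.sqrt (m%:R : R) < N%:R ->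
  exists K : nat, [/\ (0 < K <= N)%N, Num.sqrt (m%:R : R) <= K%:R
    & K%:R - 1 <= Num.sqrt (m%:R : R)].
Proof.
move=> m0 hN.
have sqE (j : nat) : (m <= j ^ 2)%N = (Num.sqrt (m%:R : R) <= j%:R).
  by rewrite -(ler_nat R) natrX -ler_sqrt ?exprn_ge0 // sqrtr_sqr ger0_norm.
have ex : exists j, (m <= j ^ 2)%N by exists N; rewrite sqE ltW.
(* The upper bound is the failure of [m <= j ^ 2] at the predecessor of [K]. *)
case: (ex_minnP ex) => -[|K] mK minK; first by move: mK m0; case: m {hN sqE ex minK}.
exists K.+1; split; first by rewrite minK // sqE ltW.
  by rewrite -sqE.
rewrite -natr1 addrK ltW // ltNge -sqE; apply/negP => /minK; by rewrite ltnn.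
Qed.

Lemma ln4_ge1 (R : realType) : 1 <= ln (4 : R).
Proof.
have : ln (2^-1 : R) <= - 2^-1.
  rewrite [X in ln X](_ : _ = 1 + - 2^-1); last by field.
  by apply: le_ln1Dx; lra.
rewrite lnV ?posrE // (_ : 4 = 2 * 2); last by ring.
by rewrite lnM ?posrE //; lra.
Qed.

Lemma normc_le_supnorm (R : realType) (m : nat) (f : 'I_m -> R[i]) (x : 'I_m) :
  normc (f x) <= supnorm f.
Proof. exact: (le_bigmax_cond _ (fun x => normc (f x))). Qed.

(** * The bound for short sums *)

Lemma progression_sum_le (R : realType) (m : nat) (hm : (0 < m)%N)
    (phi : 'I_m -> R[i]) (C : R) (a : int) (N : nat) :
  (forall x, normc (phi x) <= C) ->
  (forall h : 'I_m, normc (fourier phi h%:Z) <= C) ->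
  Num.sqrt (m%:R : R) < N%:R -> (N <= m)%N ->
  normc (\sum_(i < N) phi (residue hm (a + i%:Z)))
    <= C * Num.sqrt m%:R * ln (4 * expR 8 * N%:R / Num.sqrt m%:R).
Proof.
move=> phi_le hat_le hN Nm.
have C0 : 0 <= C := le_trans (normc_ge0 _) (phi_le (Ordinal hm)).
have [K [KN sK Ks]] := exists_ceil_sqrt hm hN; have [K0 KN'] := andP KN.
set r := Num.sqrt _ in hN sK Ks *.
have r2 : r * r = m%:R by rewrite -expr2 sqr_sqrtr.
have r0 : 0 < r by rewrite sqrtr_gt0 ltr0n.
have K0R : 0 < K%:R :> R by rewrite ltr0n.
have N0R : 0 < N%:R :> R by rewrite ltr0n (leq_trans K0).
have NmR : N%:R <= r * r by rewrite r2 ler_nat.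
have := normc_interval_sum_le (fun n => phi_le (residue hm n)) N K a.
have := smoothed_sum_le hm a hat_le KN Nm; rewrite -/r.
set S := normc (\sum_(i < N) _); set T := normc _ => hT hS.
set L := ln (N%:R / K%:R) in hT.
have hL : L <= ln (N%:R / r).
  by rewrite /L ler_ln ?posrE ?divr_gt0 // ler_pM2l // lef_pV2.
have hS' : S <= C / r * (N%:R + m%:R * (L + 7)) + (K%:R - 1) * C.
  rewrite -(ler_pM2l K0R); apply: le_trans hS _.
  apply: le_trans (lerD hT (lexx _)) _.
  by rewrite le_eqVlt; apply/orP; left; apply/eqP; ring.
have Nr0 : 0 < N%:R / r by rewrite divr_gt0.
rewrite -!mulrA lnM ?posrE ?(mulr_gt0 (expR_gt0 _)) //.
rewrite lnM ?posrE ?expR_gt0 // expRK.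
apply: le_trans hS' _; rewrite -r2.
have -> : C / r * (N%:R + r * r * (L + 7)) + (K%:R - 1) * C
   = C * (N%:R / r + r * (L + 7) + (K%:R - 1)).
  by field; rewrite gt_eqF.
rewrite ler_wpM2l //.
have : N%:R / r <= r by rewrite ler_pdivrMr.
have : r * (L + 9) <= r * (ln 4 + (8 + ln (N%:R / r))).
  by rewrite ler_pM2l //; have := ln4_ge1 R; lra.
lra.
Qed.

Local Open Scope fset_scope.

Theorem theorem1p1 (R : realType) (m : nat) (hm : (0 < m)%N)
    (phi : 'I_m -> R[i]) (I : {fset int}) (hI : is_int_interval I)
    (hI_gt : Num.sqrt (m%:R : R) < #|` I|%:R) (hI_le : (#|` I| <= m)%N) :
  let c : R :=
    Num.max (supnorm phi) (supnorm (fun h : 'I_m => fourier phi h%:Z)) in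
  Normc.normc (\sum_(n <- I) phi (residue hm n)) <=
    c * Num.sqrt (m%:R) *
      ln (4 * expR 8 * #|` I|%:R / Num.sqrt (m%:R)).
Proof.
cbv zeta; set c := Num.max _ _.
have c_phi x : normc (phi x) <= c by rewrite le_max normc_le_supnorm.
have c_hat (h : 'I_m) : normc (fourier phi h%:Z) <= c.
  by rewrite le_max (normc_le_supnorm (fun h : 'I_m => fourier phi h%:Z)) orbT.
have I0 : I != fset0.
  by rewrite -cardfs_gt0 -(ltr0n R); apply: le_lt_trans hI_gt; exact: sqrtr_ge0.
have [a aI] := interval_enum hI I0.
rewrite (perm_big _ aI) big_map -[#|` I|]subn0 big_mkord subn0.
exact: progression_sum_le.
Qed.
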